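(* Let $X$ be a complex Banach space, $1\leq\lambda<\infty$ and $1\leq p<\infty$. Then for every $n\in\mathbb{N}$ and every $1\leq q<\infty$, $$\frac{r_p(\mathbb{D},X,\lambda)}{n}\ \leq\ A_p(B_{\ell^n_q},X,\lambda)\ \leq\ \left(\frac{r_p(\mathbb{D},X,\lambda)}{n^{1/p}}\right)^{1/q}.$$
   Context: $\mathbb{D}$ is the open unit disk in $\mathbb{C}$ and $B_{\ell^n_q}=\{z\in\mathbb{C}^n:(\sum_{i=1}^n|z_i|^q)^{1/q}<1\}$. For $\Omega=\mathbb{D}$ (with $n=1$) or $\Omega=B_{\ell^n_q}$ and holomorphic $f:\Omega\to X$, write $f(z)=\sum_{\alpha\in\mathbb{N}_0^n}x_\alpha(f)z^\alpha$ with $x_\alpha(f)\in X$, where $\mathbb{N}_0=\mathbb{N}\cup\{0\}$, and $\|f\|_\Omega=\sup_{z\in\Omega}\|f(z)\|\in[0,\infty]$. $H_\infty(\Omega,X)$ is the set of bounded holomorphic maps $\Omega\to X$. $r_p(\mathbb{D},X,\lambda)$ is the supremum of all $r\in[0,1]$ such that $\sup_{z\in r\mathbb{D}}\sum_{k=0}^\infty\|x_k(f)z^k\|^p\leq\lambda\|f\|_{\mathbb{D}}^p$ for all holomorphic $f:\mathbb{D}\to X$. The $\lambda_p$-arithmetic Bohr radius is $$A_p(\Omega,X,\lambda)=\sup\left\{\frac1n\sum_{i=1}^n r_i: r\in\mathbb{R}^n_{\geq0},\ \sum_{\alpha\in\mathbb{N}_0^n}\|x_\alpha(f)\|^p r^{p\alpha}\leq\lambda\|f\|_\Omega^p\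 \text{ for all } f\in H_\infty(\Omega,X)\right\},$$ where $\mathbb{R}^n_{\geq0}$ is the set of $r=(r_1,\dots,r_n)\in\mathbb{R}^n$ with all $r_i\geq0$.
   Formalization: The Banach space X is assumed nonzero: for X = {0} every r is admissible, so the arithmetic Bohr radius is infinite while r_p(D,X,λ) = 1, and the stated upper bound fails. *)

(* Defs.v *)
From mathcomp Require Export all_boot all_order all_algebra.
From mathcomp Require Export all_classical all_reals all_analysis.
From mathcomp Require Export complex.
From mathcomp Require Export showcase.summability.

Set Implicit Arguments.
Unset Strict Implicit.
Unset Printing Implicit Defensive.

Import Order.TTheory GRing.Theory Num.Theory numFieldNormedType.Exports.

Local Open Scope classical_set_scope.
Local Open Scope ring_scope.
Local Open Scope complex_scope.

(* Over the scalar field C = R[i] the library norm `|x| is an element of R[i]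
   (real and nonnegative); rnorm is the same number as an element of R. *)
Definition rnorm (R : realType) (V : normedZmodType R[i]) (x : V) : R :=
  complex.Re `|x|.

Definition unit_disk (R : realType) : set R[i]^o := [set z | rnorm z < 1].

Definition lq_ball (R : realType) (n : nat) (q : R) : set 'rV[R[i]]_n :=
  [set z | (\sum_(i < n) rnorm (z ord0 i) `^ q) `^ q^-1 < 1].

(* Maps on Omega are total functions of which only the values on the open set
   Omega matter; differentiable is complex Frechet differentiability. *)
Definition holomorphic_on (R : realType) (V X : normedModType R[i])
    (Omega : set V) (f : V -> X) : Prop :=
  forall z, Omega z -> differentiable f z.

Definition sup_norm (R : realType) (T : Type) (X : normedModType R[i])
    (Omega : set T) (f : T -> X) : \bar R :=
  ereal_sup [set (rnorm (f z))%:E | z in Omega].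

Definition Hinfty (R : realType) (V X : normedModType R[i])
    (Omega : set V) (f : V -> X) : Prop :=
  holomorphic_on Omega f /\ (sup_norm Omega f < +oo)%E.

Definition multiindex (n : nat) := {ffun 'I_n -> nat}.

Definition monomial (K : comPzRingType) (n : nat) (z : 'rV[K]_n)
    (a : multiindex n) : K :=
  \prod_(i < n) z ord0 i ^+ a i.

(* x is the family of Taylor coefficients of f: f(z) = \sum_k x_k z^k on D,
   resp. f(z) = \sum_a x_a z^a on Omega, the sum over multi-indices being the
   limit along the finite sets of multi-indices.  On D and on the balls of l_q
   every holomorphic f has exactly one such family, so quantifying over all
   pairs (f, x) below amounts to quantifying over f. *)
Definition taylor_coefs1 (R : realType) (X : normedModType R[i])
    (f : R[i]^o -> X) (x : nat -> X) : Prop :=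
  forall z, unit_disk z -> series (fun k => z ^+ k *: x k) @ \oo --> f z.

Definition taylor_coefs (R : realType) (X : normedModType R[i]) (n : nat)
    (Omega : set 'rV[R[i]]_n) (f : 'rV[R[i]]_n -> X)
    (x : multiindex n -> X) : Prop :=
  forall z, Omega z ->
    partial_sum (fun a => monomial z a *: x a) @ totally --> f z.

(* r_p(D, X, lambda) *)
Definition bohr_radius (R : realType) (X : normedModType R[i])
    (p lambda : R) : R :=
  sup [set r : R | 0 <= r <= 1 /\
    forall (f : R[i]^o -> X) (x : nat -> X),
      holomorphic_on (@unit_disk R) f -> taylor_coefs1 f x ->
      (ereal_sup [set \sum_(0 <= k <oo) (rnorm (z ^+ k *: x k) `^ p)%:E |
                    z in [set (r%:C * w)%R | w in @unit_disk R]]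
       <= lambda%:E * sup_norm (@unit_disk R) f `^ p)%E].

(* A_p(Omega, X, lambda); r^(p a) is \prod_i r_i^(p a_i), with 0^0 = 1. *)
Definition arithmetic_bohr_radius (R : realType) (X : normedModType R[i])
    (n : nat) (Omega : set 'rV[R[i]]_n) (p lambda : R) : \bar R :=
  ereal_sup [set ((n%:R)^-1 * \sum_(i < n) r ord0 i)%:E | r in
    [set r : 'rV[R]_n | (forall i, 0 <= r ord0 i) /\
      forall (f : 'rV[R[i]]_n -> X) (x : multiindex n -> X),
        Hinfty Omega f -> taylor_coefs Omega f x ->
        (\esum_(a in [set: multiindex n])
            (rnorm (x a) `^ p * \prod_(i < n) r ord0 i `^ (p * (a i)%:R))%:E
         <= lambda%:E * sup_norm Omega f `^ p)%E]].

(* Main.v *)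
(** Lower bound: for an admissible [r] of the Bohr radius the vector
    [(r, 0, ..., 0)] is admissible for the arithmetic Bohr radius, because a
    function on the ball restricts to the first axis.

    Upper bound: put [c = n ^ (1/q - 1)], so that [z |-> c (z_1 + ... + z_n)]
    maps the ball into the disk, and let [r] be admissible with mean [A].  The
    function [f (c (z_1 + ... + z_n))] has the coefficients [m_a c^|a| x_|a|]
    with multinomial [m_a], and [m_a ^ p >= m_a] shows that
    [s = (sum_i (c r_i)^p)^(1/p)] satisfies the Bohr inequality.  Testing with
    [z ^ k] for all [k] gives [c sum_i r_i <= 1], hence [s <= 1] and
    [s <= r_p], and also [A <= n^(-1/q)].  Two applications of the power mean
    inequality turn this into [A^q <= c A <= r_p / n^(1/p)]. *)

Require Import Defs.
From mathcomp Require Import finmap ring lra.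

Import Order.TTheory GRing.Theory Num.Theory numFieldNormedType.Exports.
Local Open Scope ring_scope.
Local Open Scope complex_scope.

Set Implicit Arguments.
Unset Strict Implicit.
Unset Printing Implicit Defensive.

Local Open Scope classical_set_scope.

(** * Norms and powers *)

Section rnorm.
Variables (R : realType) (V : normedModType R[i]).
Implicit Types x y : V.

Lemma rnormE x : (rnorm x)%:C = `|x|.
Proof.
have := normr_ge0 x; rewrite lecE => /andP[/eqP im0 _].
by rewrite [RHS]complexE im0 mulr0 addr0.
Qed.

Lemma rnorm_ge0 x : 0 <= rnorm x.
Proof. by rewrite -lecR rnormE normr_ge0. Qed.

Lemma rnorm0 : rnorm (0 : V) = 0.
Proof. by rewrite /rnorm normr0. Qed.

Lemma rnorm_gt0 x : x != 0 -> 0 < rnorm x.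
Proof. by move=> x0; rewrite -ltcR rnormE normr_gt0. Qed.

Lemma ler_rnormD x y : rnorm (x + y) <= rnorm x + rnorm y.
Proof. by rewrite -lecR rmorphD /= !rnormE ler_normD. Qed.

Lemma rnormZ (a : R[i]) x : rnorm (a *: x) = rnorm (a : R[i]^o) * rnorm x.
Proof.
apply: (@complexI R); rewrite rmorphM /= !rnormE.
exact: (@normrZ _ V a x).
Qed.

Lemma ler_rnorm_sum (I : Type) (s : seq I) (P : pred I) (F : I -> V) :
  rnorm (\sum_(i <- s | P i) F i) <= \sum_(i <- s | P i) rnorm (F i).
Proof.
elim/big_rec2: _ => [|i b a _ ab]; first by rewrite rnorm0.
by apply: (le_trans (ler_rnormD _ _)); rewrite lerD2l.
Qed.

(** A positive element of [R[i]] is real by the definition of the order, so real [e] suffice to test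
    convergence. *)
Lemma cvg_rnormP (T : Type) (F : set_system T) (FF : Filter F) (f : T -> V)
    (l : V) :
  f @ F --> l <-> forall e : R, 0 < e -> \forall t \near F, rnorm (l - f t) < e.
Proof.
split=> [/cvgrPdist_lt fl e e0|fl].
  have := fl e%:C; rewrite ltcR => /(_ e0); apply: filterS => t.
  by rewrite -rnormE ltcR.
apply/cvgrPdist_lt => e e0.
have ee : e = (complex.Re e)%:C.
  by move: e0; rewrite ltcE => /andP[/eqP im _]; rewrite [LHS]complexE im mulr0 addr0.
rewrite ee; apply: filterS (fl (complex.Re e) _) => [t|].
  by rewrite -[_ < _]ltcR rnormE.
by rewrite -ltcR -ee.
Qed.

End rnorm.

Section rnormC.
Variable R : realType.
Implicit Types z w : R[i]^o.

Lemma rnorm_real (t : R) : 0 <= t -> rnorm (t%:C : R[i]^o) = t.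
Proof. by move=> t0; apply: (@complexI R); rewrite rnormE ger0_norm ?lecR. Qed.

Lemma rnormM z w : rnorm ((z : R[i]) * w : R[i]^o) = rnorm z * rnorm w.
Proof. exact: (@rnormZ R R[i]^o z w). Qed.

Lemma rnorm1 : rnorm (1 : R[i]^o) = 1.
Proof. exact: (@rnorm_real 1). Qed.

Lemma rnormX z n : rnorm ((z : R[i]) ^+ n : R[i]^o) = rnorm z ^+ n.
Proof.
elim: n => [|n IH]; first by rewrite !expr0 rnorm1.
by rewrite !exprS -IH -rnormM.
Qed.

Lemma rnorm_prod (I : Type) (s : seq I) (P : pred I) (F : I -> R[i]^o) :
  rnorm (\prod_(i <- s | P i) (F i : R[i]) : R[i]^o)
  = \prod_(i <- s | P i) rnorm (F i).
Proof.
elim/big_rec2: _ => [|i b a _ <-]; first by rewrite rnorm1.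
by rewrite -rnormM.
Qed.

End rnormC.

Section powR_facts.
Variable R : realType.

Lemma powR_exprn (a s : R) k : 0 <= a -> (a ^+ k) `^ s = (a `^ s) ^+ k.
Proof.
move=> a0; elim: k => [|k IH]; first by rewrite !expr0 powR1.
by rewrite !exprS powRM ?exprn_ge0 // IH.
Qed.

Lemma powRK (a s : R) : 0 <= a -> 0 < s -> (a `^ s) `^ s^-1 = a.
Proof. by move=> a0 s0; rewrite -powRrM mulfV ?gt_eqF // powRr1. Qed.

Lemma powRVK (a s : R) : 0 <= a -> 0 < s -> (a `^ s^-1) `^ s = a.
Proof. by move=> a0 s0; rewrite -powRrM mulVf ?gt_eqF // powRr1. Qed.

Lemma powR_prod (I : finType) (F : I -> R) (e : I -> nat) (s : R) :
  (forall i, 0 <= F i) ->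
  \prod_i (F i `^ s) ^+ e i = (\prod_i F i ^+ e i) `^ s.
Proof.
move=> F0; elim: (index_enum I) => [|i l IH]; first by rewrite !big_nil powR1.
rewrite !big_cons powRM ?exprn_ge0 ?prodr_ge0 // => [|j _]; last exact: exprn_ge0.
by rewrite -IH powR_exprn.
Qed.

(** Power mean inequality. With [m] the mean and [t] the exponent conjugate to [s], Young's
    inequality bounds [a i * m ^ (s - 1)] by [a i ^ s / s + m ^ s / t]. Summing over [i] gives
    [n * m ^ s] on the left, and the terms in [m ^ s] are then collected. For [s = 1] there is no
    finite [t]. *)
Lemma mean_powR_le (n : nat) (a : 'I_n -> R) (s : R) : (0 < n)%N -> 1 <= s ->
    (forall i, 0 <= a i) ->
  n%:R * (n%:R^-1 * \sum_i a i) `^ s <= \sum_i a i `^ s.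
Proof.
move=> n0 s1 a0; have nR : 0 < n%:R :> R by rewrite ltr0n.
set m := _^-1 * _; have m0 : 0 <= m by rewrite mulr_ge0 ?invr_ge0 ?sumr_ge0 ?ltW.
have nm : n%:R * m = \sum_i a i by rewrite mulrA mulfV ?mul1r ?gt_eqF.
have [s_eq1|s_neq1] := eqVneq s 1.
  rewrite s_eq1 powRr1 // nm; under [leRHS]eq_bigr do rewrite powRr1 //.
  exact: lexx.
have {s1 s_neq1} s1 : 1 < s by rewrite lt_neqAle eq_sym s_neq1.
have s0 : 0 < s by exact: lt_trans s1.
have t0 : 0 < s - 1 by rewrite subr_gt0.
pose t := s / (s - 1).
have mst : (m `^ (s - 1)) `^ t = m `^ s.
  by rewrite -powRrM /t mulrCA mulfV ?mulr1 ?gt_eqF.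
have young i : a i * m `^ (s - 1) <= a i `^ s / s + m `^ s / t.
  rewrite -mst; apply: conjugate_powR => //; rewrite ?powR_ge0 ?divr_gt0 //.
  by rewrite /t invf_div -{1}(div1r s) -mulrDl subrKC mulfV// gt_eqF.
have : \sum_i a i * m `^ (s - 1) <= \sum_i (a i `^ s / s + m `^ s / t).
  by apply: ler_sum => i _.
rewrite big_split /= -!mulr_suml -nm sumr_const card_ord -(mulr_natl (m `^ s)).
have -> : n%:R * m * m `^ (s - 1) = n%:R * m `^ s by rewrite -mulrA mulr_powRB1.
rewrite /t invf_div -lerBlDr -mulrA -mulrBr.
have -> : m `^ s - m `^ s * ((s - 1) / s) = m `^ s / s by field; rewrite gt_eqF.
by rewrite mulrA ler_pM2r ?invr_gt0.
Qed.

(* If [u > 1], write [u = v ^ (n + 1)] and bound [v ^ k] below by Bernoulli's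
   inequality. *)
Lemma poly_growth_le1 (n : nat) (u L : R) :
  (forall k, u ^+ k <= L * k.+1%:R ^+ n) -> u <= 1.
Proof.
move=> uL; rewrite leNgt; apply/negP => u1.
pose v := u `^ n.+1%:R^-1.
have u0 : 0 <= u by apply: ltW; apply: lt_trans u1.
have vu : v ^+ n.+1 = u.
  by rewrite -powR_mulrn ?powR_ge0 // -powRrM mulVf ?powRr1 // pnatr_eq0.
have v1 : 1 < v.
  rewrite -(@ltr_pXn2r _ n.+1) // ?nnegrE ?powR_ge0 //.
  by rewrite vu expr1n.
(* The cap at 1 provides the case [k = 0] of the bound [d * (k + 1) <= v ^ k]. *)
pose d := Num.min 1 (v - 1).
have d0 : 0 < d by rewrite lt_min ltr01 subr_gt0.
have dk k : d * k.+1%:R <= v ^+ k.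
  elim: k => [|k IH]; first by rewrite mulr1 expr0 ge_min lexx.
  have := IH; have dv : d <= v - 1 by rewrite ge_min lexx orbT.
  have : 1 <= v ^+ k by rewrite exprn_ege1 // ltW.
  have -> : k.+2%:R = k.+1%:R + 1 :> R by rewrite natr1.
  rewrite exprS; nra.
(* The power [n + 1] of the Bernoulli bound has one factor [k + 1] more than the assumed bound on
   [u ^ k], so a linear function of [k] stays below [L]. *)
have dL k : d ^+ n.+1 * k.+1%:R <= L.
  have kn : 0 < k.+1%:R ^+ n :> R by rewrite exprn_gt0.
  rewrite -(ler_pM2r kn) -mulrA -exprS -exprMn.
  apply: le_trans (uL k); rewrite -vu -exprM mulnC exprM.
  by rewrite lerXn2r // ?nnegrE ?exprn_ge0 ?mulr_ge0 ?powR_ge0 // ltW.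
have dn : 0 < d ^+ n.+1 by rewrite exprn_gt0.
have := dL (Num.truncn (L / d ^+ n.+1)).
rewrite mulrC -ler_pdivlMr // leNgt => /negP; apply.
apply: truncnS_gt.
Qed.

End powR_facts.

(** * Multi-indices as types of words *)

(* Words [w] of length [k] in the alphabet ['I_n] turn the multinomial theorem
   into the distributivity [bigA_distr_bigA]; [mult a] is the multinomial
   coefficient [|a|! / a!]. *)
Section words.
Variable n : nat.

Definition deg (a : multiindex n) : nat := (\sum_i a i)%N.

Definition word_type (k : nat) (w : {ffun 'I_k -> 'I_n}) : multiindex n :=
  [ffun i => #|[pred j | w j == i]|].

Definition mult (a : multiindex n) : nat :=
  #|[pred w : {ffun 'I_(deg a) -> 'I_n} | word_type w == a]|.

Lemma deg_word_type k (w : {ffun 'I_k -> 'I_n}) : deg (word_type w) = k.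
Proof.
rewrite -[RHS]card_ord -sum1_card (partition_big w xpredT) //=.
by apply: eq_bigr => i _; rewrite ffunE -sum1_card.
Qed.

Lemma prod_word (K : comPzRingType) k (w : {ffun 'I_k -> 'I_n}) (F : 'I_n -> K) :
  \prod_j F (w j) = \prod_i F i ^+ word_type w i.
Proof.
rewrite (partition_big w xpredT) //=; apply: eq_bigr => i _.
rewrite ffunE -prodr_const; apply: eq_bigr => j.
by move=> /eqP ->.
Qed.

Lemma expr_sum_words (K : comPzRingType) k (F : 'I_n -> K) :
  (\sum_i F i) ^+ k = \sum_(w : {ffun 'I_k -> 'I_n}) \prod_j F (w j).
Proof. by rewrite -[in LHS](card_ord k) -prodr_const bigA_distr_bigA. Qed.

(** Since [mult a] counts the words of type [a], each copy of [G a] can be assigned to one such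
    word. Words of length [k] have types of degree [k] only. *)
Lemma sum_mult (V : zmodType) (A : {fset multiindex n}) (k : nat)
    (G : multiindex n -> V) :
  \sum_(a <- A | deg a == k) G a *+ mult a =
  \sum_(w : {ffun 'I_k -> 'I_n} | word_type w \in A) G (word_type w).
Proof.
transitivity (\sum_(a <- A)
    \sum_(w : {ffun 'I_k -> 'I_n} | word_type w == a) G a).
  rewrite big_mkcond /=; apply: eq_bigr => a _; case: eqP => [ak|ak].
    rewrite sumr_const /mult ak.
    by congr (_ *+ _); apply: eq_card => w.
  rewrite big_pred0 // => w; apply/eqP => wa.
  by apply: ak; rewrite -wa deg_word_type.
under eq_bigr do rewrite big_mkcond /=.
rewrite exchange_big /= [RHS]big_mkcond /=; apply: eq_bigr => w _.
case: ifPn => wA.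
  rewrite (bigD1_seq _ wA (fset_uniq A)) /= eqxx big1 ?addr0 // => a.
  by rewrite eq_sym => /negPf ->.
rewrite big_seq big1 // => a aA.
by case: eqP wA => // ->; rewrite aA.
Qed.

(** A finite set that contains all multi-indices of degree below [N] and has only polynomially many
    elements in [N]. It serves both as a stage of the limit along finite sets and for counting
    coefficients. *)
Definition box (N : nat) : {fset multiindex n} :=
  [fset a in codom (fun b : {ffun 'I_n -> 'I_N} => [ffun i => b i : nat])]%fset.

Lemma mem_box N (a : multiindex n) : (deg a < N)%N -> a \in box N.
Proof.
move=> aN; have aiN i : (a i < N)%N.
  by apply: leq_ltn_trans aN; rewrite /deg (bigD1 i) //= leq_addr.
rewrite inE; apply/codomP; exists [ffun i => Ordinal (aiN i)].
by apply/ffunP => i; rewrite !ffunE.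
Qed.

Lemma size_box N : (size (box N) <= N ^ n)%N.
Proof.
rewrite card_fseq (leq_trans (size_undup _)) //.
by rewrite size_codom card_ffun !card_ord.
Qed.

Lemma sum_deg (V : zmodType) (A : {fset multiindex n}) (N : nat)
    (G : multiindex n -> V) : (forall a, a \in A -> deg a < N)%N ->
  \sum_(a <- A) G a = \sum_(k < N) \sum_(a <- A | deg a == k) G a.
Proof.
move=> AN; rewrite (exchange_big_dep xpredT) //= [LHS]big_seq [RHS]big_seq.
apply: eq_bigr => a aA; rewrite (big_pred1 (Ordinal (AN _ aA))) //=.
Qed.

End words.

(** * Lifting a function from the disk *)

(** Multiplied by [1 - s], the sum telescopes. *)
Lemma geometric_tail (R : realType) (s : R) : 0 <= s < 1 ->
  forall K M, \sum_(K <= k < M) s ^+ k <= s ^+ K / (1 - s).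
Proof.
move=> /andP[s0 s1] K M; rewrite ler_pdivlMr ?subr_gt0 // mulr_suml.
have [KM|MK] := leqP K M; last by rewrite big_geq ?exprn_ge0 // ltnW.
under eq_bigr do rewrite mulrBr mulr1 -exprSr -opprB.
by rewrite sumrN telescope_sumr // opprB gerBl exprn_ge0.
Qed.

Section power_series.
Variables (R : realType) (X : normedModType R[i]) (f : R[i]^o -> X) (x : nat -> X).
Hypothesis fx : taylor_coefs1 f x.

(** Convergence at the midpoint [u] of [t] and 1 makes [u ^ k * rnorm (x k)] eventually less than 1,
    so the terms are dominated by the geometric sequence of ratio [s = t / u < 1]. *)
Lemma taylor_coefs1_tail (t e : R) : 0 <= t < 1 -> 0 < e ->
  exists K0, forall K M, (K0 <= K)%N ->
    \sum_(K <= k < M) t ^+ k * rnorm (x k) < e.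
Proof.
move=> /andP[t0 t1] e0.
pose u : R := (1 + t) / 2.
have u0 : 0 < u by rewrite /u; lra.
have u1 : u < 1 by rewrite /u; lra.
pose s := t / u.
have s0 : 0 <= s by rewrite divr_ge0 // ltW.
have s1 : s < 1 by rewrite ltr_pdivrMr // mul1r /u; lra.
have /fx /cvgP /cvg_series_cvg_0 /cvg_rnormP : unit_disk (u%:C : R[i]^o).
  by rewrite /unit_disk /= rnorm_real // ltW.
move=> /(_ _ ltr01)[K1 _ hK1].
have : s ^+ k @[k --> \oo] --> (0 : R) by apply: cvg_expr; rewrite ger0_norm.
(* The factor [1 - s] cancels the denominator of the geometric tail. *)
move=> /cvgrPdist_lt /(_ (e * (1 - s))).
rewrite mulr_gt0 ?subr_gt0 // => /(_ isT)[K2 _ hK2].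
exists (maxn K1 K2) => K M; rewrite geq_max => /andP[K1K K2K].
apply: (@le_lt_trans _ _ (\sum_(K <= k < M) s ^+ k)).
  rewrite big_nat [leRHS]big_nat; apply: ler_sum => k /andP[Kk _].
  have := hK1 k (leq_trans K1K Kk).
  rewrite /= sub0r -scaleNr rnormZ.
  have -> : rnorm ((- u%:C ^+ k)%R : R[i]^o) = u ^+ k.
    rewrite /rnorm normrN; have := @rnormX R u%:C k; rewrite /rnorm => ->.
    by have := @rnorm_real R u (ltW u0); rewrite /rnorm => ->.
  move=> ux1; have -> : t = s * u by rewrite /s divfK // gt_eqF.
  by rewrite exprMn -mulrA ler_piMr ?exprn_ge0 // ltW.
have s01 : 0 <= s < 1 by rewrite s0.
apply: le_lt_trans (geometric_tail s01 K M) _.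
rewrite ltr_pdivrMr ?subr_gt0 //.
by have := hK2 K K2K; rewrite /= sub0r normrN ger0_norm ?exprn_ge0.
Qed.

End power_series.

(* For [f] with coefficients [x] on the disk, the coefficients of
   [z |-> f (c * (z_1 + ... + z_n))]. *)
Section lift.
Variables (R : realType) (X : normedModType R[i]) (n : nat) (c : R).

Definition scaled_sum (z : 'rV[R[i]]_n) : R[i]^o := \sum_i c%:C * z ord0 i.

Definition lift_coefs (x : nat -> X) (a : multiindex n) : X :=
  (c ^+ deg a *+ mult a)%:C *: x (deg a).

Lemma scaled_sum_differentiable z : differentiable scaled_sum z.
Proof.
rewrite /scaled_sum (_ : (fun _ => _) =
   \sum_(i < n) (fun z : 'rV[R[i]]_n => c%:C *: (z ord0 i : R[i]^o))); last first.
  by apply/funext => y; rewrite fct_sumE.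
apply: differentiable_sum => i; apply: differentiableZ.
exact: differentiable_coord.
Qed.

Hypothesis c_ge0 : 0 <= c.

Lemma rnorm_scaled_sum z : rnorm (scaled_sum z) <= c * \sum_i rnorm (z ord0 i : R[i]^o).
Proof.
apply: (le_trans (ler_rnorm_sum _ _ _)); rewrite mulr_sumr.
by apply: ler_sum => i _; rewrite rnormM rnorm_real.
Qed.

(** Over words, the homogeneous part of degree [k] is the expansion of [scaled_sum z ^ k] with the
    words of type outside [A] left out. Hence it is exact for large [A], and dominated by absolute
    values for every [A]. *)
Lemma lift_coefs_words x z (A : {fset multiindex n}) k :
  \sum_(a <- A | deg a == k) monomial z a *: lift_coefs x a =
  \sum_(w : {ffun 'I_k -> 'I_n} | word_type w \in A)
     (\prod_j (c%:C * z ord0 (w j))) *: x k.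
Proof.
transitivity (\sum_(a <- A | deg a == k)
    ((\prod_i (c%:C * z ord0 i) ^+ a i) *: x (deg a)) *+ mult a).
  apply: eq_bigr => a _; rewrite /lift_coefs scalerA rmorphMn /= mulrnAr.
  rewrite scalerMnl; congr (_ *+ _ *: _).
  under [in RHS]eq_bigr do rewrite exprMn.
  by rewrite big_split /= prodrXr rmorphXn mulrC.
rewrite sum_mult; apply: eq_bigr => w _.
by rewrite deg_word_type (prod_word w (fun i => c%:C * z ord0 i)).
Qed.

Lemma lift_coefs_full x z (A : {fset multiindex n}) k N :
  (k < N)%N -> (box n N `<=` A)%fset ->
  \sum_(a <- A | deg a == k) monomial z a *: lift_coefs x a
  = scaled_sum z ^+ k *: x k.
Proof.
move=> kN /fsubsetP NA; rewrite lift_coefs_words expr_sum_words scaler_suml.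
by apply: eq_bigl => w; rewrite NA // mem_box // deg_word_type.
Qed.

(** After absolute values are taken word by word, the missing words can be added back, as they
    contribute nonnegative terms. *)
Lemma lift_coefs_le x z (A : {fset multiindex n}) k :
  rnorm (\sum_(a <- A | deg a == k) monomial z a *: lift_coefs x a)
  <= (c * \sum_i rnorm (z ord0 i : R[i]^o)) ^+ k * rnorm (x k).
Proof.
rewrite lift_coefs_words; apply: (le_trans (ler_rnorm_sum _ _ _)).
rewrite mulr_sumr expr_sum_words mulr_suml big_mkcond /=.
apply: ler_sum => w _; rewrite rnormZ rnorm_prod.
under eq_bigr do rewrite rnormM rnorm_real //.
case: ifP => // _; rewrite mulr_ge0 ?rnorm_ge0 // prodr_ge0 // => j _.
by rewrite mulr_ge0 ?rnorm_ge0.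
Qed.

(** The sum is split at degree [K]. Once [A] contains [box n K], the parts of degree below [K] are
    complete and form a partial sum of the series of [f] at [scaled_sum z]. The higher parts may be
    incomplete, but the absolute tail at [t] bounds them. *)
Lemma taylor_coefs_lift (Omega : set 'rV[R[i]]_n) (f : R[i]^o -> X) x :
  (forall z, Omega z -> c * \sum_i rnorm (z ord0 i : R[i]^o) < 1) ->
  taylor_coefs1 f x ->
  taylor_coefs Omega (f \o scaled_sum) (lift_coefs x).
Proof.
move=> Omega1 fx z /Omega1 z1.
set t := c * _ in z1.
have t0 : 0 <= t by rewrite mulr_ge0 // sumr_ge0 // => i _; apply: rnorm_ge0.
have t01 : 0 <= t < 1 by rewrite t0.
apply/cvg_rnormP; first exact: totally_filter.
move=> e e0; have e20 : 0 < e / 2 by rewrite divr_gt0.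
have [K1 hK1] := taylor_coefs1_tail fx t01 e20.
have /fx /cvg_rnormP : unit_disk (scaled_sum z).
  by rewrite /unit_disk /=; apply: le_lt_trans (rnorm_scaled_sum z) _.
move=> /(_ _ e20)[K2 _ hK2]; pose K := maxn K1 K2.
exists (box n K) => // A KA.
(* [M] exceeds every degree in [A], and is at least [K] so that the sum can be cut there. *)
pose M := maxn K (\max_(a : A) (deg (val a)).+1).
have AM a : a \in A -> (deg a < M)%N.
  move=> aA; rewrite /M leq_max; apply/orP; right.
  exact: (@leq_bigmax _ (fun a : A => (deg (val a)).+1) [` aA]%fset).
pose S (a : multiindex n) := monomial z a *: lift_coefs x a.
have -> : partial_sum S A = \sum_(0 <= k < M) \sum_(a <- A | deg a == k) S a.
  by rewrite /partial_sum -(big_seq_fsetE _ _ xpredT S) (sum_deg _ AM) big_mkord.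
rewrite (big_cat_nat (n := K)) ?leq_maxl //= opprD addrA.
apply: (le_lt_trans (ler_rnormD _ _)); rewrite [ltRHS](splitr e).
apply: ltrD.
  rewrite big_nat; under eq_bigr => k /andP[_ kK] do rewrite (lift_coefs_full _ _ kK KA).
  by rewrite -big_nat; apply: hK2; rewrite /= leq_maxr.
rewrite /rnorm normrN.
apply: (le_lt_trans (ler_rnorm_sum _ _ _)).
apply: le_lt_trans (hK1 K M (leq_maxl _ _)).
by apply: ler_sum => k _; apply: lift_coefs_le.
Qed.

End lift.

(** * Bohr radius of the disk *)

Lemma nneseries_le (R : realType) (u : nat -> \bar R) (C : \bar R) :
  (forall k, 0 <= u k)%E -> (forall K, \sum_(0 <= k < K) u k <= C)%E ->
  (\sum_(0 <= k <oo) u k <= C)%E.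
Proof.
move=> u0 uC; apply: lime_le; first by apply: is_cvg_nneseries => k _ _.
by apply: nearW => K; apply: uC.
Qed.

Section sup_norm.
Variables (R : realType) (X : normedModType R[i]).

Lemma sup_norm_ge (T : Type) (Omega : set T) (f : T -> X) z :
  Omega z -> ((rnorm (f z))%:E <= sup_norm Omega f)%E.
Proof. by move=> Oz; apply: ereal_sup_ubound; exists z. Qed.

Lemma sup_norm_ge0 (T : Type) (Omega : set T) (f : T -> X) :
  Omega !=set0 -> (0 <= sup_norm Omega f)%E.
Proof.
move=> [z Oz]; apply: le_trans (sup_norm_ge f Oz).
by rewrite lee_fin rnorm_ge0.
Qed.

Lemma sup_norm_comp (S T : Type) (D : set S) (Omega : set T) (h : S -> T)
    (f : T -> X) : (forall z, D z -> Omega (h z)) ->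
  (sup_norm D (f \o h) <= sup_norm Omega f)%E.
Proof.
move=> hD; apply: ge_ereal_sup => _ [z Dz <-].
exact: sup_norm_ge (hD z Dz).
Qed.

Lemma le_scaled_poweR (lambda p : R) (s t : \bar R) : 0 <= lambda -> 0 <= p ->
  (0 <= s -> s <= t -> lambda%:E * s `^ p <= lambda%:E * t `^ p)%E.
Proof.
move=> l0 p0 s0 st; apply: lee_wpmul2l; first by rewrite lee_fin.
by apply: gt0_ler_poweR => //; rewrite in_itv /= leey andbT // (le_trans _ st).
Qed.

Lemma unit_disk_nonempty : @unit_disk R !=set0.
Proof. by exists 0; rewrite /unit_disk /= rnorm0. Qed.

End sup_norm.

Section disk.
Variables (R : realType) (X : normedModType R[i]) (p : R).
Hypothesis p_ge1 : 1 <= p.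

Lemma unit_disk_real (t : R) : 0 <= t < 1 -> unit_disk (t%:C : R[i]^o).
Proof. by move=> /andP[t0 t1]; rewrite /unit_disk /= rnorm_real. Qed.

Lemma powR_rnormZ (z : R[i]^o) (x : X) k :
  rnorm ((z : R[i]) ^+ k *: x) `^ p = (rnorm z `^ p) ^+ k * rnorm x `^ p.
Proof.
rewrite rnormZ (rnormX z) powRM ?rnorm_ge0 ?exprn_ge0 ?rnorm_ge0 //.
by rewrite powR_exprn ?rnorm_ge0.
Qed.

(* On the circle of radius [r] itself: let [|w|] tend to 1 in the definition of
   the Bohr radius. *)
Lemma bohr_series_le (x : nat -> X) (r : R) (C : \bar R) : 0 <= r ->
  (ereal_sup [set \sum_(0 <= k <oo) (rnorm (z ^+ k *: x k) `^ p)%:E |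
       z in [set (r%:C * w)%R | w in @unit_disk R]] <= C)%E ->
  (\sum_(0 <= k <oo) ((r `^ p) ^+ k * rnorm (x k) `^ p)%:E <= C)%E.
Proof.
move=> r0 supC; have p0 : 0 < p by apply: lt_le_trans p_ge1.
apply: nneseries_le => [k|K].
  by rewrite lee_fin mulr_ge0 ?exprn_ge0 ?powR_ge0.
rewrite sumEFin; set S := \sum_(_ <= _ < _) _.
have S0 : 0 <= S by apply: sumr_ge0 => k _; rewrite mulr_ge0 ?exprn_ge0 ?powR_ge0.
have vS v : 0 < v < 1 -> ((v * S)%:E <= C)%E.
  (* With this choice [u ^ (p * (K + 1)) = v], so passing from radius [r] to [r * u] costs each of
     the first [K] terms at most a factor [v]. *)
  move=> /andP[v0 v1]; pose u := v `^ (K.+1%:R * p)^-1.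
  have one_powR (s : R) : 1 `^ s = 1 by rewrite powR1.
  have Kp : 0 < K.+1%:R * p by rewrite mulr_gt0.
  have u0 : 0 < u by apply: powR_gt0.
  have u1 : u < 1.
    rewrite -(one_powR (K.+1%:R * p)^-1); apply: gt0_ltr_powR => //.
    - by rewrite invr_gt0.
    - by rewrite nnegrE ltW.
    - by rewrite nnegrE.
  have uv : (u `^ p) ^+ K.+1 = v.
    by rewrite -powR_mulrn ?powR_ge0 // -powRrM mulrC -powRrM mulVf ?powRr1 ?gt_eqF ?ltW.
  have up : u `^ p <= 1.
    by rewrite -(one_powR p); apply: ge0_ler_powR; rewrite ?nnegrE ?ler01 // ltW.
  apply: le_trans supC; apply: le_ereal_sup_tmp.
  exists (\sum_(0 <= k <oo) (rnorm ((r%:C * u%:C) ^+ k *: x k) `^ p)%:E)%E.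
    exists (r%:C * u%:C) => //; exists u%:C => //; apply: unit_disk_real.
    by rewrite u1 ltW.
  apply: le_trans (nneseries_lim_ge K _); last by move=> k _ _; rewrite lee_fin powR_ge0.
  rewrite sumEFin lee_fin /S mulr_sumr big_nat [leRHS]big_nat.
  apply: ler_sum => k /andP[_ kK].
  rewrite (powR_rnormZ (r%:C * u%:C)) rnormM !rnorm_real ?(ltW u0) //.
  rewrite powRM ?(ltW u0) // exprMn mulrA ler_wpM2r ?powR_ge0 // mulrC.
  rewrite ler_wpM2l ?exprn_ge0 ?powR_ge0 // -uv.
  by rewrite ler_wiXn2l ?powR_ge0 // ltnW // ltnW.
have half01 : 0 < (1 / 2 : R) < 1 by apply/andP; split; lra.
case: C vS {supC} => [c| |] vS; last 2 first.
- by rewrite leey.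
- by have := vS _ half01.
rewrite lee_fin leNgt; apply/negP => cS.
have c0 : 0 <= c.
  by have := vS _ half01; rewrite lee_fin; apply: le_trans; rewrite mulr_ge0.
have S_gt0 : 0 < S by apply: le_lt_trans cS.
(* If [c < S], this [v] puts [v * S] at the midpoint of [c] and [S], above the bound [c]. *)
have := vS ((c + S) / (2 * S)); rewrite lee_fin.
have -> : (c + S) / (2 * S) * S = (c + S) / 2 by field; rewrite gt_eqF.
rewrite divr_gt0 ?mulr_gt0 ?ltr_wpDl //= ltr_pdivrMr ?mulr_gt0 //.
have -> : c + S < 1 * (2 * S) by lra.
by move=> /(_ isT); lra.
Qed.

(** At radius 0 only the constant term [x 0 = f 0] survives, and [lambda >= 1] absorbs it. Thus 0
    always belongs to the set whose supremum is the Bohr radius. *)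
Lemma bohr0 (lambda : R) (f : R[i]^o -> X) (x : nat -> X) : 1 <= lambda ->
  taylor_coefs1 f x ->
  (ereal_sup [set \sum_(0 <= k <oo) (rnorm (z ^+ k *: x k) `^ p)%:E |
       z in [set ((0 : R)%:C * w)%R | w in @unit_disk R]]
   <= lambda%:E * sup_norm (@unit_disk R) f `^ p)%E.
Proof.
move=> l1 fx; have p0 : 0 < p by apply: lt_le_trans p_ge1.
have D0 : unit_disk (0 : R[i]^o) by rewrite /unit_disk /= rnorm0.
have f0 : f 0 = x 0%N.
  apply: (cvg_unique (@norm_hausdorff _ X) (fx 0 D0)).
  apply/cvg_rnormP => e e0; exists 1%N => //= -[//|N] _.
  rewrite /series /= big_nat_recl // expr0 scale1r big1 ?addr0 ?subrr ?rnorm0 // => k _.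
  by rewrite exprS mul0r scale0r.
apply: ge_ereal_sup => _ [_ [w _ <-] <-].
have sD : (rnorm (x 0%N) `^ p)%:E%E = ((rnorm (f 0))%:E `^ p)%E.
  by rewrite f0 poweR_EFin.
apply: (@le_trans _ _ (rnorm (x 0%N) `^ p)%:E).
  apply: nneseries_le => [k|[|K]]; rewrite ?lee_fin ?powR_ge0 //.
    by rewrite big_geq // lee_fin powR_ge0.
  rewrite sumEFin lee_fin big_nat_recl // expr0 scale1r big1 ?addr0 // => k _.
  by rewrite mul0r exprS mul0r scale0r rnorm0 powR0 // gt_eqF.
rewrite sD -[leLHS]mul1e; apply: le_trans (_ : lambda%:E * (rnorm (f 0))%:E `^ p <= _)%E.
  by rewrite lee_wpmul2r // ?poweR_ge0 // lee_fin.
apply: le_scaled_poweR; rewrite ?lee_fin ?rnorm_ge0 ?(ltW p0) //.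
- exact: le_trans l1.
- exact: sup_norm_ge.
Qed.

End disk.

(** * Restriction to the first axis *)

Section axis.
Variable m : nat.

Definition axis (k : nat) : multiindex m.+1 :=
  [ffun i => if i == ord0 then k else 0%N].

Lemma axis0 k : axis k ord0 = k. Proof. by rewrite ffunE eqxx. Qed.

Lemma axis_inj : injective axis.
Proof. by move=> k l /(congr1 (fun a : multiindex m.+1 => a ord0)); rewrite !axis0. Qed.

Lemma deg_axis k : deg (axis k) = k.
Proof.
rewrite /deg (bigD1 ord0) //= axis0 big1 ?addn0 // => i /negPf i0.
by rewrite ffunE i0.
Qed.

Lemma off_axis (a : multiindex m.+1) : ~ range axis a ->
  exists2 i, i != ord0 & (0 < a i)%N.
Proof.
move=> aN; apply: contrapT => aP; apply: aN; exists (a ord0) => //.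
apply/ffunP => i; rewrite ffunE; case: eqVneq => [->//|i0].
apply/esym/eqP; rewrite -leqn0 leqNgt; apply/negP => ai.
by apply: aP; exists i.
Qed.

(** The factors are kept general to cover both monomials and the weights with real exponents; the
    hypothesis is the convention [0 ^ 0 = 1] in either case. *)
Lemma prod_axis (K : comPzRingType) (F : 'I_m.+1 -> nat -> K) k :
  (forall i, F i 0%N = 1) -> \prod_i F i (axis k i) = F ord0 k.
Proof.
move=> F1; rewrite (bigD1 ord0) //= axis0 big1 ?mulr1 // => i /negPf i0.
by rewrite ffunE i0 F1.
Qed.

Lemma prod_off_axis (K : comPzRingType) (F : 'I_m.+1 -> nat -> K) a :
  (forall i l, i != ord0 -> (0 < l)%N -> F i l = 0) -> ~ range axis a ->
  \prod_i F i (a i) = 0.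
Proof.
by move=> F0 /off_axis[i i0 ai]; rewrite (bigD1 i) //= F0 ?mul0r.
Qed.

Definition axis_vec (K : pzRingType) (w : K) : 'rV[K]_m.+1 := w *: delta_mx 0 ord0.

Lemma axis_vecE (K : pzRingType) (w : K) i :
  axis_vec w ord0 i = if i == ord0 then w else 0.
Proof. by rewrite !mxE eqxx /=; case: eqP; rewrite ?mulr1 ?mulr0. Qed.

Lemma monomial_axis (K : comPzRingType) (w : K) k :
  monomial (axis_vec w) (axis k) = w ^+ k.
Proof.
rewrite /monomial (prod_axis (F := fun i l => axis_vec w ord0 i ^+ l)) ?axis_vecE //.
Qed.

Lemma monomial_off_axis (K : comPzRingType) (w : K) a :
  ~ range axis a -> monomial (axis_vec w) a = 0.
Proof.
apply: (prod_off_axis (F := fun i l => axis_vec w ord0 i ^+ l)) => i l i0 l0.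
by rewrite axis_vecE (negPf i0) expr0n gtn_eqF.
Qed.

Section restriction.
Variables (R : realType) (X : normedModType R[i]) (Omega : set 'rV[R[i]]_m.+1).
Hypothesis axis_Omega : forall w, @unit_disk R w -> Omega (axis_vec w).

Lemma holomorphic_axis (f : 'rV[R[i]]_m.+1 -> X) : holomorphic_on Omega f ->
  holomorphic_on (@unit_disk R) (fun w : R[i]^o => f (axis_vec w)).
Proof.
move=> hf w Dw; apply: (differentiable_comp (f := fun w : R[i]^o => axis_vec w)).
  exact: differentiableZl.
exact: hf (axis_Omega Dw).
Qed.

Lemma taylor_coefs_axis (f : 'rV[R[i]]_m.+1 -> X) (x : multiindex m.+1 -> X) :
  taylor_coefs Omega f x ->
  taylor_coefs1 (fun w => f (axis_vec w)) (x \o axis).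
Proof.
move=> fx w /axis_Omega /fx /cvg_rnormP fw.
apply/cvg_rnormP => e e0; have [A0 _ hA] := fw (totally_filter) e e0.
exists (\max_(a : A0) (deg (val a)).+1) => // N /= A0N.
have A0deg a : a \in A0 -> (deg a < N)%N.
  move=> aA; apply: leq_trans A0N.
  exact: (@leq_bigmax _ (fun a : A0 => (deg (val a)).+1) [` aA]%fset).
(* The first [N] axis indices are added to [A0]. As [A0] has only degrees below [N], these are all
   the axis indices in [A], and the other monomials vanish on the axis. *)
pose A := (A0 `|` [fset a in [seq axis k | k <- iota 0 N]])%fset.
have Adeg a : a \in A -> (deg a < N)%N.
  rewrite !inE => /orP[/A0deg//|/mapP[k]].
  by rewrite mem_iota => /andP[_ kN] ->; rewrite deg_axis.
pose S a := monomial (axis_vec w) a *: x a.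
suff -> : series (fun k => w ^+ k *: (x \o axis) k) N = partial_sum S A.
  by apply: hA; apply: fsubsetUl.
rewrite /partial_sum -(big_seq_fsetE _ _ xpredT S) (sum_deg _ Adeg).
rewrite /series /= big_mkord; apply: eq_bigr => k _.
have kA : axis k \in A.
  by rewrite !inE; apply/orP; right; apply: map_f; rewrite mem_iota /= add0n.
rewrite big_mkcond /= (bigD1_seq _ kA (fset_uniq A)) /= deg_axis eqxx.
rewrite big1 ?addr0 ?/S ?monomial_axis // => a ak.
case: eqP => // dak; rewrite /S monomial_off_axis ?scale0r //.
by move=> [l _ la]; rewrite -la deg_axis in dak; rewrite -la dak eqxx in ak.
Qed.

(** Off the axis a weight contains a factor [0 ^ (p * l)] with [l > 0], which is 0 because [p > 0].
    The remaining sum is reindexed along the injection [axis]. *)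
Lemma esum_axis (x : multiindex m.+1 -> X) (p r : R) : 0 < p -> 0 <= r ->
  (\esum_(a in [set: multiindex m.+1])
     (rnorm (x a) `^ p * \prod_(i < m.+1) axis_vec r ord0 i `^ (p * (a i)%:R))%:E
   = \sum_(0 <= k <oo) ((r `^ p) ^+ k * rnorm (x (axis k)) `^ p)%:E)%E.
Proof.
move=> p0 r0; pose P (a : multiindex m.+1) :=
  \prod_(i < m.+1) axis_vec r ord0 i `^ (p * (a i)%:R).
pose u a := (rnorm (x a) `^ p * P a)%:E.
transitivity (\esum_(a in [set: multiindex m.+1])
    if a \in range axis then u a else 0)%E.
  apply: eq_esum => a _; case: ifPn => //; rewrite notin_setE => aN.
  rewrite /u /P (prod_off_axis (F := fun i l => axis_vec r ord0 i `^ (p * l%:R))) ?mulr0 //.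
  move=> i l i0 l0; rewrite axis_vecE (negPf i0) powR0 //.
  by rewrite mulf_neq0 ?gt_eqF // ltr0n.
rewrite -esum_mkcond esum_image; last by move=> k l _ _; apply: axis_inj.
rewrite nneseries_esumT; last first.
  by move=> k; rewrite lee_fin mulr_ge0 ?exprn_ge0 ?powR_ge0.
apply: eq_esum => k _; rewrite /u /P.
rewrite (prod_axis (F := fun i l => axis_vec r ord0 i `^ (p * l%:R))); last first.
  by move=> i; rewrite mulr0 powRr0.
by rewrite axis_vecE eqxx mulrC powRrM powR_mulrn ?powR_ge0.
Qed.

End restriction.
End axis.

Lemma lq_ball_axis (R : realType) m (q : R) w : 1 <= q -> @unit_disk R w ->
  lq_ball q (axis_vec m w).
Proof.
move=> q1 Dw; have q0 : q != 0 by rewrite gt_eqF // (lt_le_trans _ q1).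
rewrite /lq_ball /= big_ord_recl /= big1 ?addr0.
  by rewrite axis_vecE eqxx -powRrM mulfV // powRr1 // (@rnorm_ge0 R R[i]^o).
by move=> i _; rewrite axis_vecE /= (@rnorm0 R R[i]^o) powR0.
Qed.

(** * Necessary conditions for admissibility *)

Lemma sum_fset_le_esum (R : realType) (T : choiceType) (A : {fset T}) (u : T -> R) :
  ((\sum_(a <- A) u a)%:E <= \esum_(a in [set: T]) (u a)%:E)%E.
Proof.
apply: esum_ge; exists [set` A]; first by split=> //; apply: finite_fset.
by rewrite fsbig_finite ?finite_fset // set_fsetK sumEFin.
Qed.

Lemma differentiable_expr (K : numFieldType) k (z : K^o) :
  differentiable (fun w : K^o => (w : K) ^+ k : K^o) z.
Proof.
elim: k => [|k IH].
  under eq_fun do rewrite expr0.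
  exact: differentiable_cst.
under eq_fun do rewrite exprS.
by apply: (@differentiableM K K^o id).
Qed.

Section admissible.
Variables (R : realType) (X : normedModType R[i]) (n : nat)
  (Omega : set 'rV[R[i]]_n) (p lambda c : R) (r : 'rV[R]_n).
Hypotheses (p_ge1 : 1 <= p) (lambda_ge1 : 1 <= lambda) (c_ge0 : 0 <= c)
  (Omega_neq0 : Omega !=set0) (r_ge0 : forall i, 0 <= r ord0 i).
Hypothesis Omega1 : forall z, Omega z -> c * \sum_i rnorm (z ord0 i : R[i]^o) < 1.
Hypothesis r_adm : forall (f : 'rV[R[i]]_n -> X) (x : multiindex n -> X),
  Hinfty Omega f -> taylor_coefs Omega f x ->
  (\esum_(a in [set: multiindex n])
      (rnorm (x a) `^ p * \prod_(i < n) r ord0 i `^ (p * (a i)%:R))%:E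
   <= lambda%:E * sup_norm Omega f `^ p)%E.

Lemma scaled_sum_disk z : Omega z -> unit_disk (scaled_sum c z).
Proof.
by move=> /Omega1; rewrite /unit_disk /=; apply: le_lt_trans (rnorm_scaled_sum _ _).
Qed.

Lemma Hinfty_lift (f : R[i]^o -> X) : Hinfty (@unit_disk R) f ->
  Hinfty Omega (f \o @scaled_sum R n c).
Proof.
move=> [hf bf]; split; last first.
  by apply: le_lt_trans bf; apply: sup_norm_comp => z /scaled_sum_disk.
move=> z /scaled_sum_disk Dz; apply: differentiable_comp; last exact: hf.
exact: scaled_sum_differentiable.
Qed.

(** The factor [c ^ deg a] is distributed over the coordinates, which turns [r] into [c * r]; the
    multinomial coefficient keeps its exponent [p]. *)
Lemma lift_coefs_term (x : nat -> X) (a : multiindex n) :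
  rnorm (lift_coefs c x a) `^ p * \prod_i r ord0 i `^ (p * (a i)%:R)
  = (mult a)%:R `^ p * \prod_i ((c * r ord0 i) `^ p) ^+ a i * rnorm (x (deg a)) `^ p.
Proof.
rewrite /lift_coefs rnormZ rnorm_real ?mulrn_wge0 ?exprn_ge0 // -mulr_natl.
rewrite !powRM ?rnorm_ge0 ?mulr_ge0 ?exprn_ge0 //.
rewrite -[LHS]mulrA [in LHS](mulrC (rnorm _ `^ _)) !mulrA; congr (_ * _).
rewrite -!mulrA; congr (_ * _).
under [in RHS]eq_bigr do rewrite powRM // exprMn.
rewrite big_split /= prodrXr -/(deg a); congr (_ * _).
  by rewrite powR_exprn.
by apply: eq_bigr => i _; rewrite powRrM powR_mulrn ?powR_ge0.
Qed.

(** Admissibility of [r] is applied to the lift of [f], whose sup norm is at most that of [f]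
    because [scaled_sum c] maps [Omega] into the disk. *)
Lemma lift_sum_le (f : R[i]^o -> X) (x : nat -> X) (A : {fset multiindex n}) :
  Hinfty (@unit_disk R) f -> taylor_coefs1 f x ->
  ((\sum_(a <- A) (mult a)%:R `^ p * \prod_i ((c * r ord0 i) `^ p) ^+ a i
       * rnorm (x (deg a)) `^ p)%:E <= lambda%:E * sup_norm (@unit_disk R) f `^ p)%E.
Proof.
move=> hf fx; have p0 : 0 <= p by apply: le_trans p_ge1.
apply: le_trans (_ : lambda%:E * sup_norm Omega (f \o @scaled_sum R n c) `^ p <= _)%E; last first.
  apply: le_scaled_poweR; rewrite ?(le_trans _ lambda_ge1) //.
    exact: sup_norm_ge0.
  by apply: sup_norm_comp => z /scaled_sum_disk.
apply: le_trans (r_adm (Hinfty_lift hf) (taylor_coefs_lift c_ge0 Omega1 fx)).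
apply: le_trans (sum_fset_le_esum A _).
rewrite lee_fin; apply: ler_sum => a _.
by rewrite lift_coefs_term.
Qed.

(* Here [m ^ p >= m] for the multinomial coefficients [m]. *)
Lemma lift_series_le (f : R[i]^o -> X) (x : nat -> X) (K : nat) :
  Hinfty (@unit_disk R) f -> taylor_coefs1 f x ->
  ((\sum_(k < K) (\sum_i (c * r ord0 i) `^ p) ^+ k * rnorm (x k) `^ p)%:E
    <= lambda%:E * sup_norm (@unit_disk R) f `^ p)%E.
Proof.
move=> hf fx.
pose F i := (c * r ord0 i) `^ p.
have F0 (a : multiindex n) : 0 <= \prod_i F i ^+ a i.
  by apply: prodr_ge0 => i _; rewrite exprn_ge0 ?powR_ge0.
(* The box also has indices of degree [K] or more; only those of lower degree are kept, and these
   include the types of all words of length [k < K]. *)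
pose A := [fset a in box n K | (deg a < K)%N]%fset.
apply: le_trans (lift_sum_le A hf fx); rewrite lee_fin.
rewrite (@sum_deg _ _ A K); last by move=> a; rewrite !inE => /andP[].
apply: ler_sum => k _.
apply: (@le_trans _ _
  (\sum_(a <- A | deg a == k) ((\prod_i F i ^+ a i) * rnorm (x k) `^ p) *+ mult a)).
  rewrite sum_mult expr_sum_words mulr_suml [leRHS]big_mkcond /=.
  apply: ler_sum => w _; rewrite ifT ?(prod_word w F) //.
  have := @mem_box n K (word_type w); rewrite !inE /= deg_word_type ltn_ord.
  by move=> ->.
apply: ler_sum => a /eqP ->; rewrite -mulr_natl mulrA.
rewrite ler_wpM2r ?powR_ge0 // ler_wpM2r ?F0 //.
have [->|m0] := posnP (mult a); first by rewrite powR_ge0.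
by rewrite le1r_powR // ler1n.
Qed.

(* Test the functions [z ^ k]: each coefficient of
   [(c * (z_1 + ... + z_n)) ^ k] is bounded at [r] by [lambda `^ p^-1], and there
   are only polynomially many of them. *)
Lemma admissible_sum_le1 : (exists x : X, x != 0) -> c * \sum_i r ord0 i <= 1.
Proof.
move=> [x0 x0_neq0]; have p0 : 0 < p by apply: lt_le_trans p_ge1.
apply: (@poly_growth_le1 _ n _ (lambda `^ p^-1)) => k.
pose f (z : R[i]^o) : X := (z : R[i]) ^+ k *: x0.
pose x l : X := if l == k then x0 else 0.
have fx : taylor_coefs1 f x.
  move=> z _; apply/cvg_rnormP => e e0; exists k.+1 => // N /= kN.
  rewrite /series /= (bigD1_seq k) ?mem_index_iota ?iota_uniq //=.
  rewrite big1 => [|l /negPf lk]; last by rewrite /x lk scaler0.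
  by rewrite addr0 /x eqxx subrr rnorm0.
have supf : (sup_norm (@unit_disk R) f <= (rnorm x0)%:E)%E.
  apply: ge_ereal_sup => _ [z Dz <-]; rewrite lee_fin rnormZ (rnormX z).
  by rewrite ler_piMl ?rnorm_ge0 // exprn_ile1 ?rnorm_ge0 // ltW.
have hf : Hinfty (@unit_disk R) f.
  split; last by apply: le_lt_trans supf _; rewrite ltry.
  move=> z _; apply: differentiableZl; apply: differentiable_expr.
have term (a : multiindex n) : deg a = k ->
    (mult a)%:R * \prod_i (c * r ord0 i) ^+ a i <= lambda `^ p^-1.
  move=> ak; set t := _ * _.
  have P0 : 0 <= \prod_i (c * r ord0 i) ^+ a i.
    by apply: prodr_ge0 => i _; rewrite exprn_ge0 // mulr_ge0.
  have t0 : 0 <= t by rewrite mulr_ge0.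
  suff tl : t `^ p <= lambda.
    rewrite -(powRK t0 p0).
    apply: ge0_ler_powR; rewrite ?invr_ge0 ?nnegrE ?powR_ge0 ?(ltW p0) //.
    exact: le_trans lambda_ge1.
  have x0p : 0 < rnorm x0 `^ p by rewrite powR_gt0 // rnorm_gt0.
  (* The sum is cut down to the single index [a]; the factor [rnorm x0 ^ p], positive since [x0] is
     nonzero, then cancels. *)
  have := lift_sum_le [fset a]%fset hf fx.
  rewrite big_seq_fset1 ak /x eqxx => tf.
  have /(le_trans tf) : (lambda%:E * sup_norm (@unit_disk R) f `^ p
      <= lambda%:E * (rnorm x0)%:E `^ p)%E.
    apply: le_scaled_poweR; rewrite ?(le_trans _ lambda_ge1) ?(ltW p0) //.
    exact/sup_norm_ge0/unit_disk_nonempty.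
  rewrite poweR_EFin -EFinM lee_fin ler_pM2r // /t powRM //.
  by rewrite powR_prod // => i; rewrite mulr_ge0.
rewrite mulr_sumr expr_sum_words.
pose G (a : multiindex n) := \prod_i (c * r ord0 i) ^+ a i.
have -> : \sum_(w : {ffun 'I_k -> 'I_n}) \prod_j (c * r ord0 (w j))
    = \sum_(a <- box n k.+1 | deg a == k) G a *+ mult a.
  rewrite sum_mult; apply: eq_big => w; last by rewrite (prod_word w (fun i => c * r ord0 i)).
  by rewrite mem_box // deg_word_type.
apply: le_trans (_ : \sum_(a <- box n k.+1) lambda `^ p^-1 <= _).
  rewrite big_mkcond /=; apply: ler_sum => a _; case: eqP => [ak|_].
    by rewrite -mulr_natl term.
  exact: powR_ge0.
rewrite big_const_seq count_predT iter_addr_0 -[leLHS]mulr_natr.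
by rewrite ler_wpM2l ?powR_ge0 // -natrX ler_nat size_box.
Qed.

End admissible.

(** * The two bounds *)

(** The power mean inequality with exponent [q], after a [q]-th root, bounds [n ^ (1/q)] times the
    mean of the [|z_i|] by the norm of [z] in [l_q]. *)
Lemma lq_ball_sum_lt1 (R : realType) n (q : R) (z : 'rV[R[i]]_n) :
  (0 < n)%N -> 1 <= q -> lq_ball q z ->
  n%:R `^ q^-1 / n%:R * \sum_i rnorm (z ord0 i : R[i]^o) < 1.
Proof.
move=> n0 q1; have q0 : 0 < q by apply: lt_le_trans q1.
rewrite /lq_ball /=; apply: le_lt_trans.
have := mean_powR_le n0 q1 (fun i => @rnorm_ge0 R R[i]^o (z ord0 i)).
set m := _^-1 * _ => mq.
have m0 : 0 <= m by rewrite mulr_ge0 // sumr_ge0 // => i _; apply: rnorm_ge0.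
rewrite -mulrA -/m -[m in leLHS](powRK m0 q0).
rewrite -powRM ?powR_ge0 //; apply: ge0_ler_powR => //.
- by rewrite invr_ge0 ltW.
- by rewrite nnegrE mulr_ge0 ?powR_ge0.
- by rewrite nnegrE sumr_ge0 // => i _; rewrite powR_ge0.
Qed.

Section bohr.
Variables (R : realType) (X : normedModType R[i]) (p lambda : R).
Hypotheses (p_ge1 : 1 <= p) (lambda_ge1 : 1 <= lambda).

Let p0 : 0 < p. Proof. exact: lt_le_trans p_ge1. Qed.
Let lambda0 : 0 < lambda. Proof. exact: lt_le_trans lambda_ge1. Qed.

(** Testing bounded functions suffices, since an unbounded one has right-hand side [+oo]. Partial
    sums at [s] suffice, since [|s * w| <= s] on the disk. *)
Lemma le_bohr_radius (s : R) : 0 <= s <= 1 ->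
  (forall (f : R[i]^o -> X) (x : nat -> X) K,
     Hinfty (@unit_disk R) f -> taylor_coefs1 f x ->
     ((\sum_(k < K) (s `^ p) ^+ k * rnorm (x k) `^ p)%:E
       <= lambda%:E * sup_norm (@unit_disk R) f `^ p)%E) ->
  s <= bohr_radius X p lambda.
Proof.
move=> s01 sP; apply: ub_le_sup; first by exists 1 => t [/andP[]].
split=> // f x hf fx; apply: ge_ereal_sup => _ [_ [w Dw <-] <-].
have [/eqP supy|supf] := eqVneq (sup_norm (@unit_disk R) f) +oo%E.
  rewrite (eqP supy) poweRyr ?gt_eqF // gt0_muley ?leey //.
have bf : Hinfty (@unit_disk R) f by split; rewrite // ltey.
have [s0 s1] := andP s01.
apply: nneseries_le => [k|K]; first by rewrite lee_fin powR_ge0.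
apply: le_trans (sP f x K bf fx); rewrite sumEFin lee_fin big_mkord.
apply: ler_sum => k _; rewrite (powR_rnormZ p (s%:C * w)).
rewrite ler_wpM2r ?powR_ge0 // lerXn2r ?nnegrE ?powR_ge0 //.
apply: ge0_ler_powR; rewrite ?nnegrE ?rnorm_ge0 ?(ltW p0) //.
by rewrite rnormM rnorm_real // ler_piMr // ltW.
Qed.

Lemma arithmetic_bohr_radius_ge m (q : R) : 1 <= q ->
  ((bohr_radius X p lambda / m.+1%:R)%:E
    <= arithmetic_bohr_radius X (@lq_ball R m.+1 q) p lambda)%E.
Proof.
move=> q1; rewrite /bohr_radius.
set E := [set r | _]; set A := arithmetic_bohr_radius _ _ _ _.
have EA r : E r -> ((r / m.+1%:R)%:E <= A)%E.
  move=> [/andP[r0 r1] hr]; apply: ereal_sup_ubound.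
  exists (axis_vec m r); last first.
    rewrite (bigD1 ord0) //= axis_vecE eqxx big1 ?addr0 1?mulrC // => i /negPf i0.
    by rewrite axis_vecE i0.
  split=> [i|f x [hf bf] fx]; first by rewrite axis_vecE; case: ifP.
  rewrite esum_axis //.
  have axD w : unit_disk w -> lq_ball q (axis_vec m w) by apply: lq_ball_axis.
  have hg := holomorphic_axis axD hf; have gx := taylor_coefs_axis axD fx.
  apply: le_trans (bohr_series_le p_ge1 r0 (hr _ _ hg gx)) _.
  apply: le_scaled_poweR; rewrite ?(ltW p0) ?(ltW lambda0) //.
  - exact/sup_norm_ge0/unit_disk_nonempty.
  - by apply: sup_norm_comp.
(* The radius 0 makes [E] nonempty and excludes the value [-oo] for [A]. *)
have E0 : E 0 by split=> [|f x _ fx]; [rewrite lexx ler01|apply: bohr0].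
case: A EA => [a| |] EA; last 2 first.
- by rewrite leey.
- by have := EA _ E0.
rewrite lee_fin ler_pdivrMr ?ltr0n //; apply: ge_sup; first by exists 0.
by move=> r /EA; rewrite lee_fin ler_pdivrMr ?ltr0n.
Qed.

Lemma arithmetic_bohr_radius_le n (q : R) : (exists x : X, x != 0) ->
  (0 < n)%N -> 1 <= q ->
  (arithmetic_bohr_radius X (@lq_ball R n q) p lambda
    <= ((bohr_radius X p lambda / n%:R `^ p^-1) `^ q^-1)%:E)%E.
Proof.
move=> X_neq0 n0 q1; have q0 : 0 < q by apply: lt_le_trans q1.
apply: ge_ereal_sup => _ [r [r0 r_adm] <-]; rewrite lee_fin.
set B := bohr_radius X p lambda.
pose c := n%:R `^ q^-1 / n%:R : R.
have nR : 0 < n%:R :> R by rewrite ltr0n.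
have c0 : 0 <= c by rewrite divr_ge0 ?powR_ge0.
have ball0 : @lq_ball R n q !=set0.
  exists 0; rewrite /lq_ball /= big1 ?powR0 ?invr_eq0 ?gt_eqF // => i _.
  by rewrite mxE (@rnorm0 R R[i]^o) powR0 ?gt_eqF.
have ball1 z := @lq_ball_sum_lt1 R n q z n0 q1.
have cr0 i : 0 <= c * r ord0 i by rewrite mulr_ge0.
have cr1 := admissible_sum_le1 p_ge1 lambda_ge1 c0 ball0 r0 ball1 r_adm X_neq0.
pose T := \sum_i (c * r ord0 i) `^ p.
have T0 : 0 <= T by apply: sumr_ge0 => i _; rewrite powR_ge0.
(* Each [c * r_i] lies in [[0, 1]], being at most the full sum, so its power [p] does not exceed
   it. *)
have T1 : T <= 1.
  apply: (le_trans _ cr1); rewrite mulr_sumr; apply: ler_sum => i _.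
  have [->|cri] := eqVneq (c * r ord0 i) 0; first by rewrite powR0 // gt_eqF.
  apply: ge1r_powR => //; rewrite lt_neqAle eq_sym cri cr0 /=.
  apply: (le_trans _ cr1); rewrite (bigD1 i) //= mulrDr lerDl.
  by rewrite mulr_ge0 // sumr_ge0.
have TB : T `^ p^-1 <= B.
  apply: le_bohr_radius => [|f x K hf fx]; last first.
    by rewrite powRVK //; apply: (lift_series_le p_ge1 lambda_ge1 c0 ball0 r0 ball1 r_adm).
  have one : 1 `^ p^-1 = 1 :> R by rewrite powR1.
  rewrite powR_ge0 /= -[leRHS]one.
  by apply: ge0_ler_powR; rewrite ?nnegrE ?invr_ge0 ?(ltW p0).
set a := n%:R^-1 * _.
have a0 : 0 <= a by rewrite mulr_ge0 ?sumr_ge0 ?invr_ge0.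
(* The power mean inequality for the numbers [c * r_i] reads [n * (c * a) ^ p <= T]. *)
have caB : c * a <= B / n%:R `^ p^-1.
  rewrite ler_pdivlMr ?powR_gt0 //; apply: le_trans TB.
  have := mean_powR_le n0 p_ge1 cr0.
  rewrite -mulr_sumr mulrCA -/a -/T => naT.
  rewrite -(powRK (mulr_ge0 c0 a0) p0).
  rewrite mulrC -powRM ?powR_ge0 //; apply: ge0_ler_powR => //.
  - by rewrite invr_ge0 ltW.
  - by rewrite nnegrE mulr_ge0 ?powR_ge0.
(* Here [u = n ^ (1/q) * a] equals [c * sum_i r_i], hence [u <= 1] and [u ^ q <= u]. Dividing
   [n * a ^ q <= n ^ (1/q) * a] by [n] gives the claim. *)
have aq : a `^ q <= c * a.
  have [->|a_neq0] := eqVneq a 0; first by rewrite powR0 ?mulr0 // gt_eqF.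
  pose u := n%:R `^ q^-1 * a.
  have u1 : u <= 1 by rewrite /u mulrA -[_ * _^-1]/c.
    have a_gt0 : 0 < a by rewrite lt_neqAle eq_sym a_neq0.
  have u0 : 0 < u by apply: mulr_gt0 => //; apply: powR_gt0.
    have : u `^ q <= u by apply: ge1r_powR => //; rewrite u0.
  rewrite /u powRM ?powR_ge0 // -powRrM mulVf ?gt_eqF // powRr1 // /c.
  by rewrite mulrAC ler_pdivlMr // mulrC.
rewrite -[leLHS](powRK a0 q0).
apply: ge0_ler_powR; rewrite ?invr_ge0 ?nnegrE ?powR_ge0 ?(ltW q0) //.
  by apply: le_trans caB; rewrite mulr_ge0.
exact: le_trans caB.
Qed.

End bohr.

Theorem theorem2p3 (R : realType) (X : completeNormedModType R[i])
    (X_neq0 : exists x : X, x != 0)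
    (lambda p : R) (lambda_ge1 : 1 <= lambda) (p_ge1 : 1 <= p)
    (n : nat) (n_gt0 : (0 < n)%N) (q : R) (q_ge1 : 1 <= q) :
  ((bohr_radius X p lambda / n%:R)%:E
     <= arithmetic_bohr_radius X (@lq_ball R n q) p lambda
     <= ((bohr_radius X p lambda / n%:R `^ p^-1) `^ q^-1)%:E)%E.
Proof.
apply/andP; split; last exact: arithmetic_bohr_radius_le.
by case: n n_gt0 => // m _; exact: arithmetic_bohr_radius_ge.
Qed.
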